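(* Let $n\ge2$ be an integer. If a regulus $\mathcal{R}=\mathcal{S}_{n-1,1,q}$ of $(n-1)$-dimensional subspaces and an $(n-1)$-dimensional subspace $U$, disjoint from $\mathcal{R}$, in $\mathrm{PG}(2n-1,q)$ are contained in a Desarguesian spread, then there is an integer $c$ such that any $n$-dimensional subspace $\mathcal{H}$ of $\mathrm{PG}(2n-1,q)$ containing $U$ intersects $\mathcal{R}$ in a normal rational curve of order $c$.
   Context: All dimensions are projective. The Segre variety $\mathcal{S}_{n-1,1,q}\subset\mathrm{PG}(2n-1,q)$ is the image of the Segre embedding of $\mathrm{PG}(n-1,q)\times\mathrm{PG}(1,q)$ (up to projective equivalence). The images of $\mathrm{PG}(n-1,q)\times\{y\}$, $y\in\mathrm{PG}(1,q)$, are $q+1$ pairwise disjoint $(n-1)$-dimensional subspaces forming a regulus. The notation $\mathcal{R}=\mathcal{S}_{n-1,1,q}$ identifies the regulus with the set of points covered by its elements: ''$U$ disjoint from $\mathcal{R}$'' and ''$\mathcal{H}$ intersects $\mathcal{R}$ in ...'' refer to that point set. ''$\mathcal{R}$ and $U$ are contained in a spread'' means that $U$ and all elements of the regulus are elements of the spread. A Desarguesian spread of $(n-1)$-dimensional subspaces of $\mathrm{PG}(2n-1,q)$ is a spread projectively equivalent to the one obtained by field reduction from $\mathrm{PG}(1,q^n)$: identifying $\mathrm{PG}(2n-1,q)$ with the projective space of the $\mathbb{F}_q$-vector space $\mathbb{F}_{q^n}^2$, its elements are $\{\langle\lambda v\rangle_{\mathbb{F}_q}:\lambda\in\mathbb{F}_{q^n}^*\}$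 for $v\in\mathbb{F}_{q^n}^2\setminus\{0\}$. A normal rational curve of order $t$ is a set of points spanning a $t$-dimensional subspace and equal, in suitable homogeneous coordinates of that subspace, to $\{\langle(y_0^t,y_0^{t-1}y_1,\ldots,y_1^t)\rangle:(y_0,y_1)\in\mathbb{F}_q^2\setminus\{(0,0)\}\}$ (for $t=q$: a set of $q+1$ independent points). *)

(* Defs.v *)
From HB Require Import structures.
From mathcomp Require Import all_boot all_order all_algebra all_field.
From mathcomp Require Import classical_sets.

Set Implicit Arguments.
Unset Strict Implicit.
Unset Printing Implicit Defensive.

Import GRing.Theory.
Local Open Scope ring_scope.
Local Open Scope classical_set_scope.

(* PG(m - 1, q) is modelled by an m-dimensional vector space V over a field F
   with q elements: a subspace of projective dimension d is a {vspace V} of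
   vector dimension d + 1, and a point is a {vspace V} of dimension 1. *)

Section Geometry.
Variables (F : fieldType) (V : vectType F).

Definition points (W : {vspace V}) : set {vspace V} :=
  [set P : {vspace V} | \dim P = 1%N /\ (P <= W)%VS].

Definition covered (S : set {vspace V}) : set {vspace V} :=
  \bigcup_(W in S) points W.

Definition spans (S : set {vspace V}) (T : {vspace V}) : Prop :=
  forall W : {vspace V},
    (T <= W)%VS <-> (forall P : {vspace V}, S P -> (P <= W)%VS).

(* Coordinates (x_i y_j) of the Segre embedding, listed row by row. *)
Definition segre (n : nat) (x : 'rV[F]_n) (y : 'rV[F]_2) : 'rV[F]_(n * 2) :=
  mxvec (x^T *m y).

(* The bijective linear map g is the projective equivalence; allowing
   semilinear maps would give the same reguli, since coordinatewise field
   automorphisms permute the subspaces PG(n - 1, q) x {y}. *)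
Definition is_regulus (n : nat) (R : set {vspace V}) : Prop :=
  exists2 g : 'Hom('rV[F]_(n * 2), V), bijective g &
    R = [set W : {vspace V} | exists2 y : 'rV[F]_2, y != 0 &
           [set` W] = range (fun x : 'rV[F]_n => g (segre x y))].

(* Field reduction from PG(1, q^n): L is an extension of F of degree n, and
   L * L is regarded as a vector space over F. *)
Definition is_desarguesian_spread (n : nat) (D : set {vspace V}) : Prop :=
  exists L : fieldExtType F, \dim {:L} = n /\
    exists2 g : 'Hom((L * L)%type, V), bijective g &
      D = [set W : {vspace V} | exists2 v : L * L, v != 0 &
             [set` W] = range (fun l : L => g (l * v.1, l * v.2))].

(* The basis b gives the homogeneous coordinates of the span T.  The spanning
   condition forces t <= q. *)
Definition is_normal_rational_curve (t : nat) (S : set {vspace V}) : Prop :=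
  exists T : {vspace V}, [/\ \dim T = t.+1, spans S T &
    exists2 b : t.+1.-tuple V, basis_of T b &
      S = [set P : {vspace V} | exists y0 y1 : F, (y0, y1) != (0, 0) /\
             P = <[\sum_(i < t.+1) (y0 ^+ (t - i) * y1 ^+ i) *: b`_i]>%VS]].

End Geometry.

(* Main.v *)
Require Import Defs.
From HB Require Import structures.
From mathcomp Require Import all_boot all_order all_algebra all_field.
From mathcomp Require Import classical_sets ring.

Set Implicit Arguments.
Unset Strict Implicit.
Unset Printing Implicit Defensive.

Import GRing.Theory.
Local Open Scope ring_scope.
Local Open Scope classical_set_scope.

(** Let L be the extension of F of degree n, so that the spread consists of the
    L-lines of L * L.

    Coordinates.  Each element L v of the spread that lies in the regulus is
    linearly parametrized by F^n, and the parametrizations over y = (1, 0),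
    (0, 1) and (1, 1) add up.  Choosing e1 and e2 so that e1 + e2 spans the third
    element forces, for every x in F^n, the three images of x to be
    l e1, l e2 and l (e1 + e2) with one and the same l in L.  So the regulus is
    { L (y0 e1 + y1 e2) }, the subline PG(1, q) of PG(1, q^n) in a suitable
    frame (regulus_frame).  Then U = L (t e1 + e2) with t outside F because U
    avoids the regulus; taking e1 and u = t e1 + e2 as new frame, U becomes the
    axis 0 * L and the element of parameter y becomes
    { (l (y0 - y1 t), y1 l) | l in L } (regulus_and_disjoint_element).

    Section.  A subspace H of vector dimension n + 1 through U is F eta * L for
    some nonzero eta, so it meets the element of parameter y in the single point
    (eta, eta y1 / (y0 - y1 t)).  Multiplication by eta is linear over F, which is
    why the order of the curve does not depend on H.

    The curve.  If P is a form of degree c over F without zeros over F and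
    with P(t, 1) = 0, then multiplying the point by P(y0, y1) gives
    (eta P, eta y1 G), where G = P / (y0 - y1 t) is a form of degree c - 1 over L.
    These are forms of degree c in y, and their c + 1 coefficient vectors are
    independent over F as long as 1, t, ..., t^(c-1) are.  So P is the minimal
    polynomial of t when its degree is at most q.  When the degree of t over F
    exceeds q, the q + 1 points turn out to be independent, and X^q - X + 1, which
    takes the value 1 on all of F, does the same job with
    G = (P - P(t)) / (X - t), up to rescaling the second coordinate by 1 - P(t).
    Thus c = min([F(t) : F], q) (exists_curve_polynomial, projected_points_nrc).
    Since c <= q, the q + 1 points span the space of the curve
    (veronese_span). *)

(** * The regulus as a subline of the spread *)

Section FieldReduction.
Variables (F : fieldType) (V : vectType F).

Lemma mem_range_vspace (A : Type) (f : A -> V) (W : {vspace V}) :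
  [set` W] = range f -> forall x : V, x \in W <-> exists a : A, f a = x.
Proof.
move=> E x; have /= <- := congr1 (fun S => S x) (esym E).
by split=> [[a _ <-]|[a <-]]; exists a.
Qed.

Lemma vspace_of_range (A : vectType F) (f : {linear A -> V}) :
  exists W : {vspace V}, [set` W] = range f.
Proof.
exists (limg (linfun f)); apply/seteqP; split=> x /=.
  by case/memv_imgP=> a _ ->; exists a => //; rewrite lfunE.
by case=> a _ <-; rewrite -[f a]lfunE memv_img ?memvf.
Qed.

Variable L : fieldExtType F.

(** The map of L * L sending the standard basis to (e1, e2); its injectivity is
    how independence of e1 and e2 over L is expressed below. *)
Definition comb (e1 e2 p : L * L) : L * L :=
  (p.1 * e1.1 + p.2 * e2.1, p.1 * e1.2 + p.2 * e2.2).

Lemma comb_is_linear e1 e2 : linear (comb e1 e2).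
Proof.
move=> a p r; rewrite /comb /=; congr pair; rewrite /= scalerDr;
  by rewrite !scalerAl !mulrDl addrACA.
Qed.

HB.instance Definition _ e1 e2 := GRing.isLinear.Build F (L * L)%type
  (L * L)%type _ (comb e1 e2) (comb_is_linear e1 e2).

Lemma comb_bij e1 e2 : (forall p, comb e1 e2 p = 0 -> p = 0) ->
  bijective (linfun (comb e1 e2)).
Proof.
move=> inj; have k0 : lker (linfun (comb e1 e2)) == 0%VS.
  apply/lker0P=> p r; rewrite !lfunE => E; apply/eqP; rewrite -subr_eq0.
  by apply/eqP/inj; rewrite linearB /= E subrr.
by exists (linfun (comb e1 e2))^-1%VF; [apply: lker0_lfunK|apply: lker0_lfunVK].
Qed.

Lemma segre_coord n (x : 'rV[F]_n) (y : 'rV[F]_2) :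
  segre x y = y 0 0 *: segre x (delta_mx 0 0) + y 0 1 *: segre x (delta_mx 0 1).
Proof.
have -> : 1 = lift 0 0 :> 'I_2 by apply: val_inj.
rewrite /segre {1}(row_sum_delta y) big_ord_recl big_ord1 mulmxDr linearD /=.
by rewrite -!scalemxAr !linearZ.
Qed.

Lemma segre_disjoint n (x x' : 'rV[F]_n) :
  segre x (delta_mx 0 0) = segre x' (delta_mx 0 1) -> x = 0 /\ x' = 0.
Proof.
move=> /(can_inj mxvecK) /matrixP E.
by split; apply/rowP=> i; [have := E i 0 | have := E i 1];
  rewrite !mxE !big_ord1 !mxE /= ?mulr1 ?mulr0.
Qed.

Definition segre_fibre n (g : 'Hom('rV[F]_(n * 2), V)) y x := g (segre x y).

Lemma segre_fibre_is_linear n g y : linear (@segre_fibre n g y).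
Proof.
move=> a x x'; rewrite /segre_fibre /segre !linearP /= mulmxDl -scalemxAl.
by rewrite !linearP.
Qed.

HB.instance Definition _ n g y := GRing.isLinear.Build F 'rV[F]_n V _
  (@segre_fibre n g y) (@segre_fibre_is_linear n g y).

(** Three elements of the regulus already determine the frame: e1 + e2 is taken
    on the element of parameter (1, 1), and every other element is then a
    combination over F of the first two parametrizations. *)
Lemma regulus_frame n (R D : set {vspace V}) (g : 'Hom((L * L)%type, V)) :
  bijective g ->
  D = [set W : {vspace V} | exists2 v : L * L, v != 0 &
         [set` W] = range (fun l : L => g (l * v.1, l * v.2))] ->
  is_regulus n R -> R `<=` D ->
  exists e1 e2 : L * L, (forall p, comb e1 e2 p = 0 -> p = 0) /\
    R = [set W : {vspace V} | exists2 y : 'rV[F]_2, y != 0 &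
         [set` W] = range (fun l => g (comb e1 e2 (y 0 0 *: l, y 0 1 *: l)))].
Proof.
move=> /bij_inj g_inj defD [h /bij_inj h_inj defR] RD.
have fibre y : y != 0 -> exists2 v : L * L, v != 0 &
    range (segre_fibre h y) = range (fun l : L => g (l * v.1, l * v.2)).
  move=> y0; have [W defW] := vspace_of_range (segre_fibre h y).
  by have : D W; [apply: RD; rewrite defR; exists y | rewrite defD -defW].
have range_sub (A B : Type) (f : A -> V) (f' : B -> V) a :
    range f = range f' -> exists b, f' b = f a.
  move=> E; have : range f (f a) by exists a.
  by rewrite E => -[b _ <-]; exists b.
have delta_neq0 j : delta_mx 0 j != 0 :> 'rV[F]_2.
  by apply/eqP=> /rowP/(_ j)/eqP; rewrite !mxE !eqxx oner_eq0.
pose y11 : 'rV[F]_2 := const_mx 1.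
have y11_neq0 : y11 != 0 by apply/eqP=> /rowP/(_ 0)/eqP; rewrite !mxE oner_eq0.
have [v0 v0n0 E0] := fibre _ (delta_neq0 0).
have [v1 v1n0 E1] := fibre _ (delta_neq0 1).
have [v2 v2n0 E2] := fibre _ y11_neq0.
have hD x y : segre_fibre h y x = y 0 0 *: segre_fibre h (delta_mx 0 0) x +
    y 0 1 *: segre_fibre h (delta_mx 0 1) x.
  by rewrite /segre_fibre segre_coord linearD !linearZ.
have lineI l v : v != 0 -> g (l * v.1, l * v.2) = 0 -> l = 0.
  case: v => v v' vn0; rewrite -(linear0 g) => /g_inj [/= lv lv']; apply/eqP.
  apply: contraR vn0 => ln0; apply/eqP; congr pair; apply/eqP.
    by move/eqP: lv; rewrite mulf_eq0 (negPf ln0).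
  by move/eqP: lv'; rewrite mulf_eq0 (negPf ln0).
have combE (w w' : L * L) p : g (comb w w' p) =
    g (p.1 * w.1, p.1 * w.2) + g (p.2 * w'.1, p.2 * w'.2) by rewrite -linearD.
(* The elements of parameters (1, 0) and (0, 1) meet trivially. *)
have indep p : comb v0 v1 p = 0 -> p = 0.
  move/(congr1 g); rewrite combE linear0 => p0.
  have [x Ex] := range_sub _ _ _ _ p.1 (esym E0).
  have [x' Ex'] := range_sub _ _ _ _ p.2 (esym E1).
  have /segre_disjoint[x0 x'0] :
      segre x (delta_mx 0 0) = segre (- x') (delta_mx 0 1).
    apply: h_inj; apply/eqP; rewrite -subr_eq0; apply/eqP.
    rewrite -[RHS]p0 -Ex -Ex'.
    by congr (_ + _); rewrite -[in RHS](opprK x') [RHS]linearN.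
  move: Ex Ex'; rewrite x0 -(opprK x') x'0 oppr0 !linear0.
  move=> /esym/lineI-/(_ v0n0) p1 /esym/lineI-/(_ v1n0) p2.
  by rewrite [p]surjective_pairing p1 p2.
(* x0 is the preimage of v2 in the third element; its images in the first two
   elements are the basis vectors e1 and e2. *)
have [x0 Ex0] := range_sub _ _ _ _ 1 (esym E2).
have [l0 El0] := range_sub _ _ _ _ x0 E0.
have [l1 El1] := range_sub _ _ _ _ x0 E1.
have v2E : v2 = comb v0 v1 (l0, l1).
  apply: g_inj; rewrite combE El0 El1 [v2]surjective_pairing -[v2.1]mul1r.
  by rewrite -[v2.2]mul1r -Ex0 hD !mxE !scale1r.
have x0n0 : x0 != 0.
  apply: contraNneq v2n0 => x00; apply/eqP/g_inj; rewrite linear0.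
  by rewrite v2E combE El0 El1 x00 !linear0 addr0.
have l0n0 : l0 != 0.
  apply: contraNneq x0n0 => l00; apply/eqP.
  suff /segre_disjoint[] :
      segre x0 (delta_mx 0 0) = segre 0 (delta_mx 0 1) by [].
  apply: h_inj.
  by rewrite [LHS](esym El0) l00 !mul0r /segre trmx0 mul0mx !linear0.
have l1n0 : l1 != 0.
  apply: contraNneq x0n0 => l10; apply/eqP.
  suff /segre_disjoint[] :
      segre 0 (delta_mx 0 0) = segre x0 (delta_mx 0 1) by [].
  apply: h_inj.
  by rewrite [RHS](esym El1) l10 !mul0r /segre trmx0 mul0mx !linear0.
pose e1 := (l0 * v0.1, l0 * v0.2); pose e2 := (l1 * v1.1, l1 * v1.2).
have eE p : comb e1 e2 p = comb v0 v1 (p.1 * l0, p.2 * l1).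
  by rewrite /comb /= !mulrA.
exists e1, e2; split=> [p|].
  rewrite eE => /indep[/eqP p1 /eqP p2]; move: p1 p2.
  rewrite !mulf_eq0 (negPf l0n0) (negPf l1n0) !orbF => /eqP p1 /eqP p2.
  by rewrite [p]surjective_pairing p1 p2.
(* The unique decomposition of l v2 along the first two elements shows that x
   acts by the same scalar l on e1 and e2. *)
have key x l y : segre_fibre h y11 x = g (l * v2.1, l * v2.2) ->
    segre_fibre h y x = g (comb e1 e2 (y 0 0 *: l, y 0 1 *: l)).
  move=> E; have [m Em] := range_sub _ _ _ _ x E0.
  have [m' Em'] := range_sub _ _ _ _ x E1.
  have Emm : comb v0 v1 (m, m') = comb v0 v1 (l * l0, l * l1).
    apply: g_inj; rewrite combE Em Em'; move: E; rewrite hD !mxE !scale1r => ->.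
    by rewrite v2E /comb /= !mulrDr !mulrA.
  have [Em0 Em1] : (m, m') = (l * l0, l * l1).
    apply/eqP; rewrite -subr_eq0; apply/eqP/indep.
    by rewrite linearB /= Emm subrr.
  rewrite hD -Em -Em' Em0 Em1 -!linearZ -linearD eE /comb.
  by rewrite -!scalerAl.
rewrite defR; apply/seteqP; split=> W [y yn0 EW]; exists y => //; rewrite EW;
  apply/seteqP; split=> _ [z _ <-].
- have [l El] := range_sub _ _ _ _ z E2; exists l => //.
  by rewrite -(key z).
- have [x Ex] := range_sub _ _ _ _ z (esym E2); exists x => //.
  exact: key.
- have [x Ex] := range_sub _ _ _ _ z (esym E2); exists x => //.
  exact: key.
- have [l El] := range_sub _ _ _ _ z E2; exists l => //.
  by rewrite -(key z).
Qed.

Definition mul_pair (v : L * L) (l : L) : L * L := (l * v.1, l * v.2).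

Lemma mul_pair_is_linear v : linear (mul_pair v).
Proof. by move=> k l m; congr pair; rewrite /= mulrDl scalerAl. Qed.

HB.instance Definition _ v := GRing.isLinear.Build F L (L * L)%type _
  (mul_pair v) (mul_pair_is_linear v).

End FieldReduction.

(** * Coordinates adapted to the disjoint spread element *)

(** The shear sending the second basis vector to t e1 + e2 makes U an axis.  An
    element t of F would put U among the elements of the regulus. *)
Lemma regulus_and_disjoint_element (F : fieldType) (V : vectType F) n
    (R D : set {vspace V}) (U : {vspace V}) :
  is_regulus n R -> is_desarguesian_spread n D -> R `<=` D -> D U ->
  points U `&` covered R = set0 ->
  exists (L : fieldExtType F) (g : 'Hom((L * L)%type, V)) (t : L),
  [/\ bijective g, (forall a : F, t != a%:A),
      [set` U] = range (fun l : L => g (0, l)) &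
      R = [set W : {vspace V} | exists2 y : 'rV[F]_2, y != 0 &
             [set` W] = range (fun l : L =>
               g (l * ((y 0 0)%:A - y 0 1 *: t), y 0 1 *: l))]].
Proof.
move=> regR [L [_ [g g_bij defD]]] RD DU disj.
have [e1 [e2 [frame defR]]] := regulus_frame g_bij defD regR RD.
have c_bij := comb_bij frame.
move: DU; rewrite {1}defD => -[v vn0 EU].
have [[a b] vE] : exists p, v = comb e1 e2 p.
  by have [c' _ cK] := c_bij; exists (c' v); rewrite -[LHS]cK lfunE.
have avoid (y : 'rV[F]_2) l : y != 0 ->
    v != comb e1 e2 (y 0 0 *: l, y 0 1 *: l).
  move=> yn0; apply/eqP=> vl.
  pose f := (g \o linfun (comb e1 e2) \o
    linfun (mul_pair ((y 0 0)%:A, (y 0 1)%:A)))%VF.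
  have fE z : f z = g (comb e1 e2 (y 0 0 *: z, y 0 1 *: z)).
    rewrite !comp_lfunE !lfunE; congr (g (comb e1 e2 (_, _)));
      by rewrite /= mulr_algr.
  have [W EW] := vspace_of_range f.
  suff : (points U `&` covered R) <[g v]>%VS by rewrite disj.
  have gv : g v \in W.
    by apply/(mem_range_vspace EW); exists l; rewrite [LHS]fE vl.
  have gvn0 : g v != 0.
    by apply: contra vn0 => /eqP; rewrite -(linear0 g) => /(bij_inj g_bij) ->.
  split; first split.
  - by rewrite dim_vline gvn0.
  - rewrite -memvE; apply/(mem_range_vspace EU).
    by exists 1; rewrite !mul1r -surjective_pairing.
  exists W; last by split; [rewrite dim_vline gvn0 | rewrite -memvE].
  rewrite defR; exists y => //; rewrite EW.
  by congr (_ @` _); apply: boolp.funext => z; exact: fE.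
(* Otherwise U would be the element of parameter (1, 0). *)
have bn0 : b != 0.
  apply/eqP=> b0; pose y : 'rV[F]_2 := delta_mx 0 0.
  have yn0 : y != 0 by apply/eqP=> /rowP/(_ 0)/eqP; rewrite !mxE oner_eq0.
  by have /eqP[] := avoid y a yn0; rewrite vE b0 !mxE /= scale1r scale0r.
pose t := a / b.
have tb : t * b = a by rewrite divfK.
pose shear := linfun (comb (1, 0) (t, 1)).
have shear_bij : bijective shear.
  apply: comb_bij => -[p p'] [/=]; rewrite !mulr0 !mulr1 add0r => /[swap] ->.
  by rewrite mul0r addr0 => ->.
pose g' := (g \o linfun (comb e1 e2) \o shear)%VF.
have g'E l m : g' (l, m) = g (comb e1 e2 (l + m * t, m)).
  rewrite /g' !comp_lfunE !lfunE; congr (g (comb e1 e2 _)).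
  by congr pair; rewrite /= !mulr1 ?mulr0 ?add0r.
exists L, g', t; split=> //.
- have eg' : g' =1 g \o linfun (comb e1 e2) \o shear.
    by move=> p; rewrite /g' !comp_lfunE.
  by apply: eq_bij (fsym eg'); apply: bij_comp shear_bij; apply: bij_comp c_bij.
- move=> k; apply/eqP=> tk; pose y : 'rV[F]_2 := \row_j if j == 0 then k else 1.
  have yn0 : y != 0 by apply/eqP=> /rowP/(_ 1)/eqP; rewrite !mxE oner_eq0.
  have /eqP[] := avoid y b yn0.
  by rewrite vE !mxE /= scale1r -tb tk -scalerAl mul1r.
- rewrite EU; apply/seteqP; split=> _ [l _ <-].
    exists (l * b) => //; rewrite g'E add0r -mulrA (mulrC b) tb vE /comb /=.
    by rewrite !mulrDr !mulrA.
  exists (l / b) => //; rewrite g'E add0r vE /comb /= !mulrDr !mulrA divfK //.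
  by rewrite (mulrAC l).
rewrite defR; apply/seteqP; split=> W [y yn0 EW]; exists y => //; rewrite EW;
  congr (_ @` _); apply: boolp.funext => l; rewrite g'E mulrBr mulr_algr.
  by rewrite -scalerAr -scalerAl subrK.
by rewrite -scalerAr -scalerAl subrK.
Qed.

(** * Polynomials without roots in F and their quotients by X - t *)

Section Evaluation.
Variables (F : fieldType) (L : fieldExtType F) (t : L).

Definition ev (Q : {poly F}) : L := (map_poly (in_alg L) Q).[t].

Lemma evD Q Q' : ev (Q + Q') = ev Q + ev Q'.
Proof. by rewrite /ev rmorphD hornerD. Qed.

Lemma evB Q Q' : ev (Q - Q') = ev Q - ev Q'.
Proof. by rewrite /ev rmorphB hornerD hornerN. Qed.

Lemma evM Q Q' : ev (Q * Q') = ev Q * ev Q'.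
Proof. by rewrite /ev rmorphM hornerM. Qed.

Lemma evC k : ev k%:P = k%:A.
Proof. by rewrite /ev map_polyC hornerC. Qed.

Lemma evX : ev 'X = t.
Proof. by rewrite /ev map_polyX hornerX. Qed.

(** Horner's scheme: the values at t of the tails of P are the partial results
    of the evaluation of P at t, hence the coefficients of the quotient of P by
    X - t. *)
Lemma ev_drop_poly (P : {poly F}) k :
  ev (drop_poly k P) = (P`_k)%:A + t * ev (drop_poly k.+1 P).
Proof.
rewrite -evX -evM -evC -evD; congr ev; apply/polyP=> i.
by rewrite !coefE; case: i => [|i]; rewrite /= ?addr0 ?add0r // addSnnS.
Qed.

(** Euclidean division of P by X - t, evaluated at a; the sum telescopes by the
    recurrence of Horner's scheme. *)
Lemma ev_quotient (P : {poly F}) (a : F) c : (size P <= c.+1)%N ->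
  (\sum_(k < c.+1) a ^+ k *: ev (drop_poly k.+1 P)) * (a%:A - t)
  = P.[a]%:A - ev P.
Proof.
move=> szP; suff tele N :
    (\sum_(k < N) a ^+ k *: ev (drop_poly k.+1 P)) * (a%:A - t) =
    \sum_(k < N) (P`_k * a ^+ k)%:A + a ^+ N *: ev (drop_poly N P) - ev P.
  rewrite tele (drop_poly_eq0 szP) /ev rmorph0 horner0 scaler0 addr0.
  by rewrite -scaler_suml -(horner_coef_wide a szP).
elim: N => [|N IH].
  by rewrite !big_ord0 mul0r drop_poly0l scale1r add0r subrr.
have step (k b p : F) (s h e : L) :
    s + k *: (p%:A + t * h) - e + k *: h * (b%:A - t) =
    s + (p * k)%:A + (k * b) *: h - e.
  rewrite scalerDr scalerA mulrBr mulr_algr -!scalerAl scalerA (mulrC k p).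
  rewrite (mulrC b k) (mulrC t h).
  move: ((p * k)%:A) (k *: (h * t)) ((k * b) *: h) => x y z.
  by ring.
by rewrite !big_ord_recr /= mulrDl IH (ev_drop_poly P N) exprSr step.
Qed.

(** Over F, the coefficients of (P - P(t)) / (X - t) are triangular in the powers
    of t, with leading terms t^(c-1-k). *)
Lemma ev_drop_free (P : {poly F}) c : P \is monic -> size P = c.+1 ->
  (forall Q : {poly F}, (size Q <= c)%N -> ev Q = 0 -> Q = 0) ->
  forall d : nat -> F, \sum_(k < c) d k *: ev (drop_poly k.+1 P) = 0 ->
  forall k, (k < c)%N -> d k = 0.
Proof.
move=> monP szP indep d d0.
pose Q := \sum_(k < c) d k *: drop_poly k.+1 P.
have Q0 : Q = 0.
  apply: indep.
    rewrite (leq_trans (size_sum _ _ _)) //; apply/bigmax_leqP=> k _.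
    rewrite (leq_trans (size_scale_leq _ _)) // size_drop_poly szP subSS.
    exact: leq_subr.
  rewrite -[RHS]d0 /ev /Q rmorph_sum horner_sum; apply: eq_bigr => k _.
  by rewrite /= map_polyZ hornerZ -[in RHS]mulr_algl.
(* The coefficient of degree c - 1 - k of Q involves only d j with j <= k. *)
elim/ltn_ind=> k IH kc.
have := congr1 (fun q : {poly F} => q`_(c - k.+1)) Q0.
rewrite coef0 /Q coef_sum (bigD1 (Ordinal kc)) //= coefZ coef_drop_poly.
rewrite subnK //.
rewrite big1 ?addr0 => [|j /eqP jk].
  by move/eqP: monP; rewrite lead_coefE szP => -> ; rewrite mulr1.
have [jlt|jge] := ltnP j k; first by rewrite IH ?scale0r ?coef0.
have {}jge : (k < j)%N.
  by rewrite ltn_neqAle jge andbT; apply/eqP=> E; apply: jk; apply: val_inj.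
rewrite coefZ coef_drop_poly nth_default ?mulr0 // szP.
by rewrite -[X in (X < _)%N](subnK kc) ltn_add2l.
Qed.

End Evaluation.

(** P is the minimal polynomial of t if its degree is at most #|F|, and
    X^#|F| - X + 1 otherwise.  The equation says that P(t) (P(a) - 1) = 0: in the
    first case P(t) = 0, in the second P(a) = 1 for all a in F.  It makes
    (P - P(t)) / (X - t) take the value (1 - P(t)) P(a) / (a - t) at a. *)
Lemma exists_curve_polynomial (F : finFieldType) (L : fieldExtType F) (t : L) :
  (forall a : F, t != a%:A) ->
  exists P : {poly F}, [/\ P \is monic, (size P <= #|F|.+1)%N,
    (forall a, P.[a] != 0),
    ev t P != 1 /\ (forall a, P.[a]%:A - ev t P = (1 - ev t P) * P.[a]%:A) &
    forall Q : {poly F}, (size Q < size P)%N -> ev t Q = 0 -> Q = 0].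
Proof.
move=> tF; have /polyOver1P[M defM] := minPolyOver 1 t.
have evM0 : ev t M = 0 by apply/eqP; rewrite /ev -defM; apply: root_minPoly.
have szM : size M = size (minPoly 1 t) by rewrite defM size_map_poly.
have monM : M \is monic.
  by have := monic_minPoly 1%VS t; rewrite defM map_monic.
have minM (Q : {poly F}) : (size Q < size M)%N -> ev t Q = 0 -> Q = 0.
  move=> szQ evQ; apply/eqP; apply: contraLR szQ => Qn0; rewrite -leqNgt szM.
  rewrite -(size_map_poly (in_alg L) Q); apply: dvdp_leq.
    by rewrite map_poly_eq0.
  by apply: minPoly_dvdp; [apply/polyOver1P; exists Q | apply/eqP].
have [szMF|szMF] := leqP (size M) #|F|.+1.
  exists M; split=> //; last first.
    by split=> [|a]; rewrite evM0 ?subr0 ?mul1r // eq_sym oner_eq0.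
  move=> a; apply/negP=> /factor_theorem[Q MQ].
  have Qn0 : Q != 0.
    apply: contraTneq monM => Q0.
    by rewrite MQ Q0 mul0r monicE lead_coef0 eq_sym oner_eq0.
  have /eqP[] := Qn0; apply: minM.
    by rewrite MQ size_Mmonic ?monicXsubC // size_XsubC addn2.
  have /eqP := evM0; rewrite MQ evM mulf_eq0 => /orP[/eqP//|].
  by rewrite evB evX evC subr_eq0 (negPf (tF a)).
have q1 := finNzRing_gt1 F.
pose r : {poly F} := 1 - 'X.
pose P : {poly F} := 'X^#|F| + r.
have szX : (size r <= 2)%N.
  by rewrite /r -opprB size_polyN -polyC1 size_XsubC.
have szlt : (size r < size ('X^#|F| : {poly F}))%N.
  by rewrite size_polyXn (leq_ltn_trans szX).
have szP : size P = #|F|.+1 by rewrite size_polyDl // size_polyXn.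
have Pa a : P.[a] = 1.
  by rewrite /P /r !hornerE expf_card /= addrAC subrr add0r.
exists P; split.
- by rewrite monicE lead_coefDl // lead_coefXn.
- by rewrite szP.
- by move=> a; rewrite Pa oner_eq0.
- split=> [|a]; last by rewrite Pa scale1r mulr1.
  apply/eqP=> evP; have : P - 1 = 0.
    apply: minM; last by rewrite evB evP -polyC1 evC scale1r subrr.
    apply: leq_ltn_trans szMF; rewrite -szP (leq_trans (size_polyD _ _)) //.
    by rewrite size_polyN size_poly1 szP geq_max leqnn.
  move/eqP; rewrite subr_eq0 => /eqP P1; move: szP q1; rewrite P1 size_poly1.
  by case=> <-.
by move=> Q szQ; apply: minM; rewrite (leq_trans szQ) // szP ltnW.
Qed.

(** * The normal rational curve *)

Lemma vlineZ (K : fieldType) (V : vectType K) (k : K) (v : V) :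
  k != 0 -> <[k *: v]>%VS = <[v]>%VS.
Proof.
move=> kn0; apply/eqP; rewrite eqEsubv -!memvE memvZ ?memv_line //=.
by rewrite -[X in X \in _](scalerK kn0) memvZ ?memv_line.
Qed.

(** A form of degree c <= #|F| vanishing on PG(1, #|F|) is zero: setting y1 = 1, a
    polynomial vanishing on F, of degree less than #|F| because the point (1, 0)
    kills its leading coefficient.  This is applied to the coordinates of b
    modulo W. *)
Lemma veronese_span (F : finFieldType) (V : vectType F) (W : {vspace V}) c
    (b : nat -> V) : (c <= #|F|)%N ->
  (forall y0 y1 : F, (y0, y1) != (0, 0) ->
     \sum_(i < c.+1) (y0 ^+ (c - i) * y1 ^+ i) *: b i \in W) ->
  forall i, (i <= c)%N -> b i \in W.
Proof.
move=> cq inW.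
pose f j (w : V) := coord (vbasis fullv) j (w - projv W w).
have fW w : w \in W <-> forall j, f j w = 0.
  split=> [wW j|f0]; first by rewrite /f projv_id // subrr linear0.
  have /coord_vbasis E := memvf (w - projv W w).
  have -> : w = projv W w; last exact: memv_proj.
  apply/eqP; rewrite -subr_eq0 E; apply/eqP/big1 => j _.
  by have := f0 j; rewrite /f => ->; rewrite scale0r.
have fsum j y0 y1 : (y0, y1) != (0, 0) ->
    \sum_(i < c.+1) y0 ^+ (c - i) * y1 ^+ i * f j (b i) = 0.
  move=> yn0; have /fW/(_ j) := inW _ _ yn0.
  rewrite /f linear_sum -sumrB linear_sum => E.
  rewrite -[RHS]E; apply: eq_bigr => i _.
  by rewrite /= linearZ -scalerBr linearZ.
move=> i ic; apply/fW=> j.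
pose Q := \poly_(k < c.+1) f j (b (c - k)%N).
have Qa a : Q.[a] = 0.
  rewrite horner_poly -[RHS](fsum j a 1).
    rewrite (reindex_inj rev_ord_inj); apply: eq_bigr => k _ /=.
    by rewrite expr1n mulr1 subSS mulrC subKn // -ltnS.
  by apply/eqP=> -[_ /eqP]; rewrite oner_eq0.
have Qc : Q`_c = 0.
  rewrite coef_poly ltnSn subnn -[RHS](fsum j 1 0).
    rewrite big_ord_recl big1 => [|k _]; last by rewrite expr0n /= mulr0 mul0r.
    by rewrite expr1n expr0 !mul1r addr0.
  by apply/eqP=> -[/eqP]; rewrite oner_eq0.
have szQ : (size Q <= c)%N.
  apply/leq_sizeP=> k; rewrite leq_eqVlt => /predU1P[<- //|ck].
  by rewrite coef_poly ltnS leqNgt ck.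
have Q0 : Q = 0.
  apply: (@roots_geq_poly_eq0 _ _ (enum F)); rewrite ?enum_uniq -?cardE.
  - by apply/allP=> a _; apply/eqP.
  - by [].
  - exact: leq_trans cq.
have := congr1 (fun q : {poly F} => q`_(c - i)) Q0.
by rewrite coef0 coef_poly ltnS leq_subr subKn.
Qed.

(** The coefficient vectors are b i = g (p eta, gamma h eta), with p and h the
    coefficients of y0^(c-i) y1^i in P and in y1 times the quotient of P - P(t) by
    the form y0 - y1 t; the factor gamma = 1 / (1 - P(t)) makes both coordinates
    proportional to those of the point with the same factor P(y0, y1) for every
    y.  The order c depends on t only, not on eta. *)
Lemma projected_points_nrc (F : finFieldType) (L : fieldExtType F)
    (V : vectType F) (g : 'Hom((L * L)%type, V)) (t : L) :
  injective g -> (forall a : F, t != a%:A) ->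
  exists c, forall eta : L, eta != 0 ->
    is_normal_rational_curve c [set Q : {vspace V} | exists y0 y1 : F,
      (y0, y1) != (0, 0) /\
      Q = <[g (eta, y1 *: eta / (y0%:A - y1 *: t))]>%VS].
Proof.
move=> g_inj tF.
have [P [monP szPq Pn0 [evPn1 evPE] indep]] := exists_curve_polynomial tF.
have szP : size P = (size P).-1.+1.
  by rewrite prednK // lt0n size_poly_eq0 monic_neq0.
move: (size P).-1 szP => c szP.
have cq : (c <= #|F|)%N by rewrite -ltnS -szP.
exists c => eta etan0.
pose h k := ev t (drop_poly k P).
pose gamma := (1 - ev t P)^-1.
have gn0 : 1 - ev t P != 0 by rewrite subr_eq0 eq_sym.
have Pc : P`_c = 1 by move/eqP: monP; rewrite lead_coefE szP.
have hc : h c.+1 = 0 by rewrite /h drop_poly_eq0 ?szP // /ev rmorph0 horner0.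
pose b i := g (P`_(c - i) *: eta, gamma * h (c - i).+1 * eta).
pose S y0 y1 := \sum_(i < c.+1) (y0 ^+ (c - i) * y1 ^+ i) *: b i.
pose w (y0 y1 : F) := g (eta, y1 *: eta / (y0%:A - y1 *: t)).
have bE (d : nat -> F) : \sum_(i < c.+1) d (c - i)%N *: b i =
    g ((\sum_(k < c.+1) d k * P`_k) *: eta,
       gamma * (\sum_(k < c.+1) d k *: h k.+1) * eta).
  rewrite (reindex_inj rev_ord_inj) /=.
  rewrite scaler_suml mulr_sumr mulr_suml.
  have -> : forall f1 f2 : 'I_c.+1 -> L, (\sum_i f1 i, \sum_i f2 i) =
     \sum_i (f1 i, f2 i) by move=> f1 f2; elim/big_rec3: _ => // i x y z _ <-.
  rewrite linear_sum; apply: eq_bigr => k _ /=.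
  rewrite /b subSS subKn -1?ltnS // -linearZ; congr (g (_, _)) => /=.
    by rewrite scalerA.
  by rewrite -scalerAr -scalerAl.
have Sa a : S a 1 = P.[a] *: w a 1.
  have atn0 : a%:A - t != 0 by rewrite subr_eq0 eq_sym.
  transitivity (\sum_(i < c.+1) a ^+ (c - i) *: b i).
    by apply: eq_bigr => i _; rewrite expr1n mulr1.
  rewrite (bE (fun k => a ^+ k)) -linearZ; congr (g (_, _)) => /=.
    congr (_ *: _); rewrite (@horner_coef_wide _ c.+1) ?szP //.
    by apply: eq_bigr => k _; rewrite mulrC.
  rewrite !scale1r; apply: (mulIf atn0); rewrite -scalerAl divfK //.
  rewrite mulrAC -(mulrA gamma) ev_quotient ?szP // evPE mulKf //.
  by rewrite mulr_algl.
have S0 a : S a 0 = a ^+ c *: w a 0.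
  rewrite /S big_ord_recl big1 => [|k _].
    2: by rewrite expr0n /= mulr0 scale0r.
  rewrite addr0 expr0 mulr1 /b /= !subn0; congr (_ *: g (_, _)).
    by rewrite Pc scale1r.
  by rewrite hc mulr0 !mul0r scale0r mul0r.
(* Homogeneity reduces the case y1 != 0 to y1 = 1. *)
have curve y0 y1 : (y0, y1) != (0, 0) ->
    exists2 k, k != 0 & S y0 y1 = k *: w y0 y1.
  have [-> yn0|y1n0 _] := eqVneq y1 0.
    exists (y0 ^+ c); last exact: S0.
    by rewrite expf_neq0 //; apply: contraNneq yn0 => ->.
  exists (y1 ^+ c * P.[y0 / y1]).
    by rewrite mulf_neq0 // expf_neq0.
  transitivity (y1 ^+ c *: S (y0 / y1) 1).
    rewrite scaler_sumr; apply: eq_bigr => i _; rewrite scalerA; congr (_ *: _).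
    rewrite expr1n mulr1 expr_div_n mulrCA; congr (_ * _).
    by rewrite -{2}(subnKC (leq_ord i)) exprD mulfK // expf_neq0.
  rewrite Sa scalerA; congr (_ *: g (_, _)).
  have -> : y0%:A - y1 *: t = y1 *: ((y0 / y1)%:A - t).
    by rewrite scalerBr scalerA (mulrC y1) divfK.
  rewrite !scale1r -(mulr_algl y1 eta) -(mulr_algl y1 (_ - t)) -mulf_div.
  by rewrite divff ?mul1r // scaler_eq0 negb_or y1n0 oner_neq0.
pose T : c.+1.-tuple V := [tuple b i | i < c.+1].
have TE (i : 'I_c.+1) : T`_i = b i.
  by rewrite -tnth_nth tnth_mktuple.
have Tfree : free T.
  apply/freeP=> d.
  rewrite (eq_bigr (fun i : 'I__ => d i *: b i)) => [|i _]; last by rewrite TE.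
  (* Indexing by the exponent c - i of y0 brings the sums to the form of bE. *)
  pose d' k := d (inord (c - k)).
  have -> : \sum_(i < c.+1) d i *: b i = \sum_(i < c.+1) d' (c - i)%N *: b i.
    by apply: eq_bigr => i _; rewrite /d' subKn -1?ltnS // inord_val.
  rewrite bE -(linear0 g) => /g_inj[E1 /eqP].
  rewrite !mulf_eq0 invr_eq0 (negPf gn0) (negPf etan0) orbF /=.
  rewrite big_ord_recr /= hc scaler0 addr0 => /eqP E2.
  have d'0 k : (k < c)%N -> d' k = 0.
    apply: ev_drop_free E2 _ => // Q szQ; apply: indep; by rewrite szP.
  have d'c : d' c = 0.
    move/eqP: E1; rewrite scaler_eq0 (negPf etan0) orbF big_ord_recr /= Pc.
    rewrite mulr1.
    by rewrite big1 ?add0r => [/eqP//|k _]; rewrite d'0 // mul0r.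
  move=> i; have -> : d i = d' (c - i)%N.
    by rewrite /d' subKn -1?ltnS // inord_val.
  by have := leq_subr i c; rewrite leq_eqVlt => /predU1P[->//|]; apply: d'0.
have SE y0 y1 : \sum_(i < c.+1) (y0 ^+ (c - i) * y1 ^+ i) *: T`_i = S y0 y1.
  by apply: eq_bigr => i _; rewrite TE.
exists <<T>>%VS; split.
- by have /eqP := Tfree; rewrite size_tuple.
- move=> W; split=> [TW Q [y0 [y1 [/curve[k kn0 Sk] ->]]]|].
    rewrite -(vlineZ _ kn0) -Sk -memvE; apply: (subvP TW).
    rewrite -SE; apply: memv_suml => i _; apply/memvZ/memv_span/mem_nth.
    by rewrite size_tuple.
  move=> SW; apply/span_subvP=> _ /tnthP[i ->]; rewrite tnth_mktuple.
  apply: (veronese_span cq) (leq_ord i) => y0 y1 yn0.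
  have [k kn0] := curve _ _ yn0; rewrite /S => ->; apply: memvZ.
  by rewrite memvE; apply: SW; exists y0, y1.
exists T; first by rewrite /basis_of eqxx.
apply/seteqP; split=> Q [y0 [y1 [yn0 ->]]]; exists y0, y1; split=> //;
  by have [k kn0 Sk] := curve _ _ yn0; rewrite SE Sk vlineZ.
Qed.

(** * Sections of the regulus through the disjoint element *)

Theorem corollary3p4 (F : finFieldType) (n : nat) (V : vectType F)
    (R D : set {vspace V}) (U : {vspace V}) :
  (2 <= n)%N ->
  \dim {:V} = (2 * n)%N ->
  is_regulus n R ->
  \dim U = n ->
  points U `&` covered R = set0 ->
  is_desarguesian_spread n D ->
  R `<=` D ->
  D U ->
  exists c : nat, forall H : {vspace V},
    \dim H = n.+1 -> (U <= H)%VS ->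
    is_normal_rational_curve c (points H `&` covered R).
Proof.
move=> _ _ regR dimU disj desD RD DU.
have [L [g [t [g_bij tF EU defR]]]] :=
  regulus_and_disjoint_element regR desD RD DU disj.
have g_inj := bij_inj g_bij.
have [c nrc] := projected_points_nrc g_inj tF.
exists c => H dimH UH.
have UHm l : g (0, l) \in H.
  by apply: (subvP UH); apply/(mem_range_vspace EU); exists l.
have [x xH xU] : exists2 x, x \in H & x \notin U.
  apply/subvPn; apply/negP=> /dimvS; by rewrite dimH dimU ltnn.
have [[eta rho] xE] : exists p, x = g p.
  by have [g' _ gK] := g_bij; exists (g' x); rewrite gK.
have etan0 : eta != 0.
  apply: contraNneq xU => eta0; apply/(mem_range_vspace EU).
  by exists rho; rewrite xE eta0.
have split_g l m : g (l, m) = g (l, 0) + g (0, m).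
  by rewrite -linearD; congr (g (_, _)); rewrite /= ?addr0 ?add0r.
have etaH : g (eta, 0) \in H.
  by move: xH; rewrite xE split_g rpredDr.
(* In these coordinates H is F eta * L. *)
have defH : H = (<[g (eta, 0%R)]> + U)%VS.
  apply/esym/eqP; rewrite eqEdim subv_add -memvE etaH UH dimH -dimU /=.
  rewrite dimv_disjoint_sum.
    rewrite dim_vline -(linear0 g) (inj_eq g_inj) -pair_eqE /= (negPf etan0).
    by rewrite add1n.
  apply/eqP; rewrite -subv0; apply/subvP=> z; rewrite memv_cap memv0.
  case/andP=> /vlineP[k ->] /(mem_range_vspace EU)[l].
  rewrite -linearZ => /g_inj[/esym/eqP]; rewrite scaler_eq0 (negPf etan0) orbF.
  by move/eqP-> => _; rewrite scale0r linear0.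
suff -> : points H `&` covered R = [set Q : {vspace V} | exists y0 y1 : F,
      (y0, y1) != (0, 0) /\
      Q = <[g (eta, y1 *: eta / (y0%:A - y1 *: t))]>%VS] by exact: nrc.
(* The elements of the regulus project isomorphically onto L along U, as t lies
   outside F. *)
have den_n0 y0 y1 : (y0, y1) != (0, 0) -> y0%:A - y1 *: t != 0.
  have [->|y1n0 _] := eqVneq y1 0.
    rewrite scale0r subr0 scaler_eq0 oner_eq0 orbF.
    by apply: contraNneq => ->.
  rewrite subr_eq0; apply: contra (tF (y0 / y1)) => /eqP E.
  by rewrite mulrC -scalerA E scalerK.
apply/seteqP; split=> Q.
  case=> -[dimQ QH] [W]; rewrite {1}defR => -[y yn0 EW] [_ QW].
  have [z zn0 QE] : exists2 z, z != 0 & Q = <[z]>%VS.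
    exists (vpick Q); first by rewrite vpick0 -dimv_eq0 dimQ.
    apply/esym/eqP; rewrite eqEdim -memvE memv_pick dimQ dim_vline.
    by rewrite vpick0 -dimv_eq0 dimQ.
  have yn0' : (y 0 0, y 0 1) != (0, 0).
    apply: contra yn0 => /eqP[y00 y01]; apply/eqP/rowP=> i; rewrite mxE.
    by case: i => -[|[|//]] ip; [rewrite -[RHS]y00|rewrite -[RHS]y01];
      congr (y 0 _); apply: val_inj.
  have d0 := den_n0 _ _ yn0'.
  exists (y 0 0), (y 0 1); split=> //.
  move: QH QW; rewrite QE -!memvE defH => /memv_addP[_ /vlineP[k ->] [u uU zE]].
  case/(mem_range_vspace EU): uU => r uE; case/(mem_range_vspace EW) => l lE.
  (* Comparing first coordinates determines l from k: a single point. *)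
  have [E1 E2] : (l * ((y 0 0)%:A - y 0 1 *: t), y 0 1 *: l) = (k *: eta, r).
    apply: g_inj; rewrite lE zE -uE -linearZ [RHS]split_g /=.
    by congr (g (_, _) + _); rewrite /= scaler0.
  have {}E1 : l = k *: (eta / ((y 0 0)%:A - y 0 1 *: t)).
    by rewrite scalerAl -E1 mulfK.
  have kn0 : k != 0.
    apply: contraNneq zn0 => k0; rewrite -lE E1 k0 scale0r mul0r scaler0.
    by rewrite linear0.
  rewrite -(vlineZ (g (eta, _)) kn0) -lE -linearZ; congr <[g (_, _)]>%VS => /=.
    by rewrite E1 -scalerAl divfK.
  by rewrite E1 -scalerAl !scalerA mulrC.
case=> y0 [y1 [yn0 ->]]; have d0 := den_n0 _ _ yn0.
set z := g _.
have zn0 : z != 0.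
  by rewrite -(linear0 g) (inj_eq g_inj) -pair_eqE /= (negPf etan0).
have dimz : \dim <[z]> = 1%N by rewrite dim_vline zn0.
split; first split=> //.
  by rewrite -memvE /z split_g rpredD.
pose f := (g \o linfun (mul_pair (y0%:A - y1 *: t, y1%:A)))%VF.
have fE l : f l = g (l * (y0%:A - y1 *: t), y1 *: l).
  by rewrite comp_lfunE lfunE; congr (g (_, _)); rewrite /= mulr_algr.
have [W EW] := vspace_of_range f.
exists W; last first.
  split=> //; rewrite -memvE; apply/(mem_range_vspace EW).
  exists (eta / (y0%:A - y1 *: t)).
  by rewrite [LHS]fE divfK // scalerAl.
rewrite defR; exists (\row_j if j == 0 then y0 else y1).
  apply: contraNneq yn0 => /rowP E.
  by move: (E 0) (E 1); rewrite !mxE /= => -> ->.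
by rewrite EW !mxE /=; congr (_ @` _); apply: boolp.funext => l; exact: fE.
Qed.
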